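(* For every real $d\ge 1$ there exists a real number $\beta(d)<\infty$ such that for all real $\beta\le\beta(d)$ the following holds. Let $G$ be a random graph distributed as $G(n,d/n)$. Then there is a constant $C<\infty$ not depending on $n$ such that, with high probability (i.e. with probability tending to $1$ as $n\to\infty$), the mixing time of the Gibbs sampler of the hardcore model with parameter $\beta$ on $G$ is $O(n^{C})$.
   Context: $G(n,p)$ is the Erdős–Rényi random graph on $n$ vertices in which each potential edge is present independently with probability $p$. Hardcore model with parameter $\beta$ on a finite graph $G=(V,E)$: the probability distribution on $\{0,1\}^V$ $$P(\sigma)=\frac1Z\exp\Big(\beta\sum_{u\in V}\sigma(u)\Big)\prod_{(u,v)\in E}1_{\{\sigma(u)\sigma(v)=0\}},$$ with $Z$ a normalizing constant. Gibbs sampler: the discrete time Markov chain on $\{\sigma:P(\sigma)>0\}$ in which, from the current configuration $\sigma$, a vertex $v\in V$ is chosen uniformly at random, $\sigma(w)$ is kept for all $w\ne v$, and the value at $v$ is resampled from the conditional distribution under $P$ given the values at all other vertices. The mixing time is the number of steps needed to guarantee that the chain, started from an arbitrary state, is within total variation distance $(2e)^{-1}$ of the stationary distribution. The constant implied in $O(n^C)$ does not depend on $n$ or on the realization of the graph. *)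

(* Defs.v *)
From mathcomp Require Import all_boot all_order all_algebra.
From mathcomp Require Import all_classical all_reals all_analysis.

Set Implicit Arguments.
Unset Strict Implicit.
Unset Printing Implicit Defensive.

Import Order.TTheory GRing.Theory Num.Theory.
Local Open Scope classical_set_scope.
Local Open Scope ring_scope.

Definition vertex_pairs (V : finType) : {set {set V}} :=
  [set e : {set V} | #|e| == 2%N]%SET.

(* A simple graph on V is its edge set: no loops, no multiple edges. *)
Definition sgraph (V : finType) : finType :=
  {E : {set {set V}} | E \subset vertex_pairs V}.

Definition edges (V : finType) (G : sgraph V) : {set {set V}} := val G.

(* The point mass of G(V, p); a probability mass function when 0 <= p <= 1.
   With p = d / n this covers all n >= d, hence all large n. *)
Definition gnp (R : realType) (V : finType) (p : R) (G : sgraph V) : R :=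
  \prod_(e in vertex_pairs V) (if e \in edges G then p else 1 - p).

Definition gnp_prob (R : realType) (n : nat) (p : R)
    (A : pred (sgraph 'I_n)) : R :=
  \sum_(G : sgraph 'I_n | A G) gnp p G.

Definition config (V : finType) : finType := {ffun V -> bool}.

(* For an edge e = {u, v}, the inner product is sigma(u) * sigma(v). *)
Definition hardcore_weight (R : realType) (V : finType) (beta : R)
    (G : sgraph V) (s : config V) : R :=
  expR (beta * \sum_(u : V) (s u)%:R) *
  \prod_(e in edges G) (((\prod_(u in e) s u)%N == 0%N)%:R).

Definition hardcore (R : realType) (V : finType) (beta : R)
    (G : sgraph V) (s : config V) : R :=
  hardcore_weight beta G s /
  \sum_(s' : config V) hardcore_weight beta G s'.

Definition agree_off (V : finType) (v : V) (s s' : config V) : bool :=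
  [forall (w | w != v), s' w == s w].

(* Transition probabilities: the last factor is the conditional probability
   of s' under P given that the configuration agrees with s off v. *)
Definition gibbs_kernel (R : realType) (V : finType) (P : config V -> R)
    (s s' : config V) : R :=
  \sum_(v : V) #|V|%:R^-1 *
    (if agree_off v s s' then P s' / \sum_(r | agree_off v s r) P r else 0).

Definition chain_law (R : realType) (T : finType) (K : T -> T -> R)
    (x : T) (t : nat) : T -> R :=
  iter t (fun mu y => \sum_(z : T) mu z * K z y) (fun y => (y == x)%:R).

Definition tv_dist (R : realType) (T : finType) (mu nu : T -> R) : R :=
  2^-1 * \sum_(x : T) `|mu x - nu x|.

(* The infimum is +oo if the chain never gets within the threshold. *)
Definition mixing_time (R : realType) (T : finType) (K : T -> T -> R)
    (nu : T -> R) : \bar R :=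
  ereal_inf [set (t%:R)%:E | t in
    [set t : nat | forall x : T,
       tv_dist (chain_law K x t) nu <= (2 * expR 1)^-1]].

Definition state_space (R : realType) (V : finType) (P : config V -> R) : finType :=
  {s : config V | 0 < P s}.

(* The kernel is reversible with respect to P, so its stationary distribution
   on the support of P is P itself. *)
Definition gibbs_mixing_time (R : realType) (V : finType)
    (P : config V -> R) : \bar R :=
  mixing_time (fun s s' : state_space P => gibbs_kernel P (val s) (val s'))
              (fun s : state_space P => P (val s)).

(* Main.v *)
Require Import Defs.
From mathcomp Require Import all_boot all_order all_algebra.
From mathcomp Require Import all_classical all_reals all_analysis.
From mathcomp Require Import ring lra.

(* Write lam = exp beta. One step of the Gibbs sampler is the random map that
   draws a site u and a bit b with P(b = 1) = lam / (1 + lam), and sets u to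
   occupied iff b = 1 and no neighbour of u is occupied. Run two copies with the
   same draws: a disagreement at u disappears when u is drawn with b = 0, and
   appears only when u is drawn with b = 1 next to a disagreement. Hence the
   disagreements started at v stay inside a growing and shrinking connected set
   A containing v: a drawn site u with b = 1 joins A when it is adjacent to A,
   and with b = 0 it leaves A unless this disconnects A from v; the process dies
   from A = {v}. On connected sets containing v this chain is reversible for the
   weight lam ^ |A|, so its occupation measure until death is proportional to
   lam ^ |A|, and its expected lifetime is a multiple of the sum of lam ^ |A|
   over all connected sets A containing v. High degree vertices only enter
   through this sum.
   In G(n, d/n) the expectation of that sum is at most e * lam as soon as
   lam * d * e <= 1, by exploring a connected set one vertex at a time. Markov's
   inequality then bounds the total over all v by lam * n ^ 2 with probability
   at least 1 - e / n, which gives mixing time O(n ^ 3). *)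

Set Implicit Arguments.
Unset Strict Implicit.
Unset Printing Implicit Defensive.

Import Order.TTheory GRing.Theory Num.Theory.
Import numFieldNormedType.Exports.
Import fintype boot.finset.
Local Open Scope classical_set_scope.
Local Open Scope ring_scope.

(** * Connected sets in the random graph *)

Definition adj (V : finType) (G : sgraph V) (u w : V) : bool :=
  [set u; w]%SET \in edges G.

Lemma adj_sym (V : finType) (G : sgraph V) (u w : V) : adj G u w = adj G w u.
Proof. by rewrite /adj setUC. Qed.

Lemma edges_card2 (V : finType) (G : sgraph V) (e : {set V}) :
  e \in edges G -> #|e| = 2%N.
Proof. by move/(subsetP (valP G)); rewrite inE => /eqP. Qed.

Lemma adj_neq (V : finType) (G : sgraph V) (u w : V) : adj G u w -> u != w.
Proof. by move/edges_card2; rewrite cards2; case: eqP. Qed.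

(* Every vertex of A is joined to S by a path inside S :|: A, expressed by
   cuts. *)
Definition reach (V : finType) (G : sgraph V) (S A : {set V}) : bool :=
  [forall B : {set V}, (B \subset A) && (B != set0) ==>
    [exists x in B, [exists y in (S :|: A) :\: B, adj G x y]]].

Lemma reachP (V : finType) (G : sgraph V) (S A : {set V}) :
  reflect (forall B : {set V}, B \subset A -> B != set0 ->
             exists x y, [/\ x \in B, y \in S :|: A, y \notin B & adj G x y])
          (reach G S A).
Proof.
apply: (iffP forallP) => h B.
  move=> BA B0; move: (h B); rewrite BA B0 /= => /exists_inP[x xB].
  by case/exists_inP=> y; rewrite inE => /andP[yB yA] xy; exists x, y.
apply/implyP => /andP[BA B0]; have [x [y [xB yA yB xy]]] := h B BA B0.
apply/exists_inP; exists x => //; apply/exists_inP; exists y => //.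
by rewrite inE yB.
Qed.

Lemma reach0 (V : finType) (G : sgraph V) (S : {set V}) : reach G S set0.
Proof. by apply/reachP => B; rewrite subset0 => ->. Qed.

Lemma reach_from0 (V : finType) (G : sgraph V) (A : {set V}) :
  reach G set0 A -> A = set0.
Proof.
move/reachP/(_ A (subxx A)); case: eqP => [//|_] /(_ isT).
by case=> x [y [_]]; rewrite set0U => -> .
Qed.

(** One exploration step: the source [s] is used up and its neighbours [C] in [A] become sources. No
    edge from a cut [B] inside [A :\: C] can end at [s], because its endpoint in [B] would then lie
    in [C]; every other exit from [B] is still available. *)
Lemma reach_step (V : finType) (G : sgraph V) (S A : {set V}) (s : V) :
  reach G S A ->
  reach G ((S :\ s) :|: [set c in A | adj G s c]%SET)
          (A :\: [set c in A | adj G s c]%SET).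
Proof.
set C := [set c in A | _]%SET; move=> /reachP h; apply/reachP => B BA B0.
have [|x [y [xB yA yB xy]]] := h B _ B0.
  by apply: subset_trans BA (subsetDl _ _).
exists x, y; split=> //; move/subsetP/(_ x xB): BA; rewrite !inE.
have [eys|ys] := eqVneq y s.
  by rewrite adj_sym eys in xy; case/andP=> /[swap] ->; rewrite xy.
by move=> _; move: yA; rewrite !inE; case: (y \in S); case: (y \in A);
  case: (adj G s y).
Qed.

(** * Sums under [gnp] and the exploration of a connected set *)

Lemma sum_gnp_subset (R : realType) (V : finType) (p : R) (D : {set {set V}}) :
  D \subset vertex_pairs V ->
  \sum_(G : sgraph V | D \subset edges G) gnp p G = p ^+ #|D|.
Proof.
move=> DV.
pose W (J : {set {set V}}) : R :=
  \prod_(e in vertex_pairs V) (if e \in J then p else 1 - p).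
rewrite (eq_bigr (fun G : sgraph V => W (val G))) //.
have -> : \sum_(G : sgraph V | D \subset edges G) W (val G) =
    \sum_(J : {set {set V}} | (J \subset vertex_pairs V) && (D \subset J)) W J.
  rewrite (reindex_omap (val : sgraph V -> _) insub) /=.
    by apply: eq_bigl => G; rewrite valK eqxx andbT (valP G).
  by move=> J /andP[JV _]; rewrite insubT.
(* [F e] and [H e] are the factors of a present and an absent [e]. They vanish when a non-pair is
   present or an edge of [D] is absent, so expanding the product of [F e + H e] leaves exactly the
   admissible [J]; the factor is [p] on [D] and 1 elsewhere. *)
pose F (e : {set V}) : R := (e \in vertex_pairs V)%:R * p.
pose H (e : {set V}) : R :=
  if e \in vertex_pairs V then (e \notin D)%:R * (1 - p) else 1.
transitivity (\prod_e (F e + H e)); last first.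
  rewrite [RHS](_ : _ = \prod_(e in D) p); last by rewrite prodr_const.
  rewrite (bigID [in D]) /= [X in _ * X]big1 ?mulr1.
    apply: eq_bigr => e eD; rewrite /F /H (subsetP DV _ eD) eD /=; ring.
  move=> e eD; rewrite /F /H eD; case: ifP => _ /=; ring.
rewrite bigA_distr [RHS](bigID [pred J : {set {set V}} |
  (J \subset vertex_pairs V) && (D \subset J)]) /= [X in _ = _ + X]big1 ?addr0.
  apply: eq_bigr => J /andP[JV DJ]; rewrite /W big_mkcond; apply: eq_bigr => e _.
  rewrite /F /H; case: ifP => [eV|/negbT eV]; rewrite ?mul1r.
    case: ifP => // /negbT eJ; rewrite (contra (subsetP DJ e) eJ) mul1r //.
  by rewrite (contraNF (subsetP JV e) eV).
move=> J; rewrite negb_and => /orP[] /subsetPn[e eJ eD].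
  by rewrite (bigD1 e) //= eJ /F (negbTE eD) mul0r mul0r.
by rewrite (bigD1 e) //= (negbTE eD) /H (subsetP DV _ eJ) eJ mul0r mul0r.
Qed.

Lemma gnp_ge0 (R : realType) (V : finType) (p : R) (G : sgraph V) :
  0 <= p <= 1 -> 0 <= gnp p G.
Proof.
move=> /andP[p0 p1]; apply: prodr_ge0 => e _; case: ifP => // _.
by rewrite subr_ge0.
Qed.

Lemma sum_gnp (R : realType) (V : finType) (p : R) :
  \sum_(G : sgraph V) gnp p G = 1.
Proof.
rewrite -[RHS](expr0 p) -(cards0 {set V}) -sum_gnp_subset ?sub0set //.
by apply: eq_bigl => G; rewrite sub0set.
Qed.

Lemma sum_subset_expr (R : realType) (V : finType) (U : {set V}) (x : R) :
  \sum_(C : {set V} | C \subset U) x ^+ #|C| = (1 + x) ^+ #|U|.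
Proof.
transitivity (\prod_(e : V) ((e \in U)%:R * x + 1)); last first.
  rewrite (bigID [in U]) /= [X in _ * X]big1 => [|e /negbTE->]; last first.
    by rewrite mul0r add0r.
  rewrite mulr1 (eq_bigr (fun=> 1 + x)) ?prodr_const // => e ->.
  by rewrite mul1r addrC.
rewrite bigA_distr [RHS](bigID [pred C : {set V} | C \subset U]) /=.
rewrite [X in _ = _ + X]big1 ?addr0 => [|C /subsetPn[e eC eU]]; last first.
  by rewrite (bigD1 e) //= eC (negbTE eU) !mul0r.
apply: eq_bigr => C CU; rewrite (bigID [in C]) /= [X in _ * X]big1.
  rewrite mulr1 -prodr_const; apply: eq_bigr => e eC.
  by rewrite eC (subsetP CU) ?mul1r.
by move=> e /negbTE ->.
Qed.

Lemma exchange_sum_setD (R : realType) (V : finType) (U : {set V})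
    (f : {set V} -> {set V} -> R) :
  \sum_(A : {set V} | A \subset U) \sum_(C : {set V} | C \subset A) f C (A :\: C)
  = \sum_(C : {set V} | C \subset U)
      \sum_(A : {set V} | A \subset U :\: C) f C A.
Proof.
rewrite (exchange_big_dep [pred C : {set V} | C \subset U]) /=; last first.
  by move=> A C AU CA; apply: subset_trans CA AU.
apply: eq_bigr => C CU.
rewrite (reindex_onto (fun A => A :|: C) (fun A => A :\: C)) /=; last first.
  by move=> A /andP[_ CA]; rewrite setDE setUIl [~: C :|: C]setUC setUCr setIT;
    apply/setUidPl.
apply: eq_big => [A|A].
  rewrite subUset CU subsetUr !andbT setDUl setDv setU0 subsetD.
  by rewrite -(sameP eqP setDidPl).
by case/andP=> _ /eqP ->.
Qed.

Section Exploration.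
Variables (R : realType) (V : finType) (p z M : R).
Hypotheses (p01 : 0 <= p <= 1) (z0 : 0 <= z) (M0 : 0 <= M).
(** [M] is a supersolution of the branching recursion: each vertex is either not a child of a given
    source, or is one at the price [z] for itself, [p] for its edge and [M] for what hangs below
    it. *)
Hypothesis zpM : (1 + z * p * M) ^+ #|V| <= M.

Let W (D : {set {set V}}) (S A : {set V}) : R :=
  \sum_(G : sgraph V | (D \subset edges G) && reach G S A) gnp p G.

Let star (s : V) (C : {set V}) : {set {set V}} :=
  [set [set s; c]%SET | c in C]%SET.

(** Each graph on the left is counted on the right at [C] equal to its own set of neighbours of [s]
    in [A], by [reach_step]. Absent edges are not recorded, so the terms overlap and only an
    inequality results. *)
Let W_step (D : {set {set V}}) (S A : {set V}) (s : V) :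
  W D S A <= \sum_(C : {set V} | C \subset A)
               W (D :|: star s C) ((S :\ s) :|: C) (A :\: C).
Proof.
rewrite /W (exchange_big_dep [pred G : sgraph V | D \subset edges G]) /=; last first.
  by move=> C G _; rewrite subUset => /andP[/andP[]].
rewrite [leRHS](bigID [pred G : sgraph V | reach G S A]) /= -[leLHS]addr0.
apply: lerD; last first.
  by apply: sumr_ge0 => G _; apply: sumr_ge0 => C _; exact: gnp_ge0.
apply: ler_sum => G /andP[DG rG].
set C := [set c in A | adj G s c]%SET.
rewrite (bigD1 C) /=.
  rewrite lerDl; apply: sumr_ge0 => ? _; exact: gnp_ge0.
have -> : C \subset A by apply/subsetP => c; rewrite inE => /andP[].
rewrite reach_step // subUset DG /= andbT.
by apply/subsetP => e /imsetP[c]; rewrite inE => /andP[_ sc] ->.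
Qed.

(** Induction on the number of unexplored vertices: a step discards [s] and moves [C] from [U] to
    the sources. Since no edge of [D] lies inside [S :|: U], the edges from [s] to [C] are new and
    each contributes its own factor [p]. *)
Lemma sum_reach_le_aux (k : nat) (D : {set {set V}}) (S U : {set V}) :
  (#|S| + #|U| <= k)%N -> [disjoint S & U]%B -> D \subset vertex_pairs V ->
  (forall e, e \in D -> ~~ (e \subset S :|: U)) ->
  \sum_(A : {set V} | A \subset U) z ^+ #|A| * W D S A <= p ^+ #|D| * M ^+ #|S|.
Proof.
have [p0 p1] := andP p01.
have base (D0 : {set {set V}}) (U0 : {set V}) : D0 \subset vertex_pairs V ->
    \sum_(A : {set V} | A \subset U0) z ^+ #|A| * W D0 set0 A <= p ^+ #|D0|.
  move=> DV; rewrite -(sum_gnp_subset p DV) (bigD1 set0) ?sub0set //=.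
  rewrite [X in _ + X]big1 ?addr0 => [|A /andP[_ A0]]; last first.
    rewrite /W big_pred0 ?mulr0 // => G; apply: contra_neqF A0 => /andP[_].
    exact: reach_from0.
  rewrite cards0 expr0 mul1r /W le_eqVlt; apply/orP; left; apply/eqP.
  by apply: eq_bigl => G; rewrite reach0 andbT.
elim: k D S U => [|k IH] D S U; have [->|[s sS]] := set_0Vmem S;
  move=> cSU dSU DV DSU.
1,3: by rewrite cards0 expr0 mulr1; exact: base.
  by move: cSU; rewrite leqn0 addn_eq0 cards_eq0 => /andP[/eqP S0];
    rewrite S0 inE in sS.
have sU : s \notin U by move/pred0P: dSU => /(_ s) /=; rewrite sS => /= ->.
apply: (@le_trans _ _ (\sum_(A : {set V} | A \subset U) \sum_(C : {set V} | C \subset A)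
   z ^+ #|C| * (z ^+ #|A :\: C| * W (D :|: star s C) ((S :\ s) :|: C) (A :\: C)))).
  apply: ler_sum => A AU.
  apply: le_trans (ler_wpM2l (exprn_ge0 _ z0) (W_step D S A s)) _.
  rewrite mulr_sumr; apply: ler_sum => C CA.
  by rewrite mulrA -exprD -(cardsID C A) (setIidPr CA).
rewrite (exchange_sum_setD U (fun C A =>
   z ^+ #|C| * (z ^+ #|A| * W (D :|: star s C) ((S :\ s) :|: C) A))).
have cS : #|S| = #|S :\ s|.+1 by rewrite (cardsD1 s S) sS.
(* Each child in [C] costs [z * p * M], so the binomial sum over [C] is [(1 + z * p * M) ^+ #|U|],
   which is at most the factor [M] owed to [s]. *)
apply: (@le_trans _ _ (\sum_(C : {set V} | C \subset U)
   p ^+ #|D| * M ^+ #|S :\ s| * (z * p * M) ^+ #|C|)); last first.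
  rewrite -mulr_sumr sum_subset_expr cS exprSr mulrA ler_wpM2l //.
    by rewrite mulr_ge0 // exprn_ge0.
  apply: le_trans zpM; rewrite ler_weXn2l ?max_card // lerDl.
  by rewrite !mulr_ge0.
apply: ler_sum => C CU; rewrite -mulr_sumr.
have sC : s \notin C by apply: contra sU; exact: (subsetP CU).
have dSC : [disjoint S :\ s & C]%B.
  by apply: disjointWl (subsetDl _ _) _; apply: disjointWr CU _.
have cSC : #|(S :\ s) :|: C| = (#|S :\ s| + #|C|)%N.
  by rewrite cardsU (_ : _ :&: _ = set0) ?cards0 ?subn0 //; apply/eqP; rewrite setI_eq0.
have cst : #|star s C| = #|C|.
  rewrite card_in_imset // => x y xC yC /setP/(_ x); rewrite !inE eqxx orbT.
  have [xs|_ /=] := eqVneq x s; first by rewrite -xs xC in sC.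
  by move=> /esym/eqP.
have dst : [disjoint D & star s C]%B.
  rewrite -setI_eq0; apply/eqP/setP => e; rewrite !inE; apply/negbTE/andP.
  case=> /DSU /negP eD /imsetP[c cC ee]; apply: eD; rewrite ee; apply/subsetP => x.
  rewrite !inE => /orP[]/eqP ->; first by rewrite sS.
  by rewrite (subsetP CU) ?orbT.
have cD : #|D :|: star s C| = (#|D| + #|C|)%N.
  rewrite cardsU (_ : _ :&: _ = set0) ?cards0 ?subn0 ?cst //.
  by apply/eqP; rewrite setI_eq0.
apply: (@le_trans _ _ (z ^+ #|C| * (p ^+ #|D :|: star s C| * M ^+ #|(S :\ s) :|: C|))).
  apply: ler_wpM2l; first exact: exprn_ge0.
  apply: IH.
  - rewrite cSC -addnA -{1}(setIidPr CU) cardsID -ltnS; apply: leq_trans cSU.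
    by rewrite cS addSn.
  - rewrite -setI_eq0; apply/eqP/setP => x; rewrite !inE.
    move/pred0P: dSU => /(_ x) /=; case: (x \in S); case: (x \in U) => //= _;
      by case: (x \in C); rewrite ?andbF.
  - rewrite subUset DV; apply/subsetP => e /imsetP[c cC ->]; rewrite inE cards2.
    by rewrite (_ : s != c) //; apply: contraNneq sC => ->.
  - move=> e; rewrite inE => /orP[/DSU|/imsetP[c cC ->]].
      apply: contra => eSU; apply: subset_trans eSU _.
      apply/subsetP => x; rewrite !inE.
      have := subsetP CU x; case: (x \in C) => [->|_]; rewrite ?orbT //.
      by case: (x \in S); case: (x \in U); rewrite ?andbF.
    apply/negP => /subsetP/(_ s); rewrite !inE eqxx (negbTE sC) (negbTE sU).
    by move=> /(_ isT).
rewrite cD cSC !exprD !exprMn le_eqVlt; apply/orP; left; apply/eqP.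
move: (z ^+ _) (p ^+ #|D|) (p ^+ _) (M ^+ #|S :\ s|) (M ^+ _) => a b c e f.
ring.
Qed.

Lemma sum_reach_le (S : {set V}) :
  \sum_(A : {set V} | A \subset ~: S)
     z ^+ #|A| * (\sum_(G : sgraph V | reach G S A) gnp p G) <= M ^+ #|S|.
Proof.
have := @sum_reach_le_aux (#|S| + #|~: S|)%N set0 S (~: S) (leqnn _).
rewrite cards0 expr0 mul1r => h; apply: le_trans (h _ _ _).
- apply: ler_sum => A _; rewrite /W le_eqVlt; apply/orP; left; apply/eqP.
  by congr (_ * _); apply: eq_bigl => G; rewrite sub0set.
- by rewrite -setI_eq0 setICr.
- exact: sub0set.
- by move=> e; rewrite inE.
Qed.
End Exploration.

(** * Random sequences and the cluster chain *)

Section RandomSequence.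
Variables (R : realType) (T : finType) (w : T -> R).

(* Expectation of F over a sequence of t independent draws from w, the head
   of the sequence being the last draw; a random map chain is then a foldr. *)
Fixpoint Eseq (t : nat) (F : seq T -> R) : R :=
  if t is t'.+1 then Eseq t' (fun s => \sum_o w o * F (o :: s)) else F [::].

Lemma eq_Eseq (t : nat) (F F' : seq T -> R) : F =1 F' -> Eseq t F = Eseq t F'.
Proof.
elim: t F F' => [|t IH] F F' FF' /=; first exact: FF'.
by apply: IH => s; apply: eq_bigr => o _; rewrite FF'.
Qed.

Lemma Eseq_sum (I : finType) (P : pred I) (t : nat) (F : I -> seq T -> R) :
  Eseq t (fun s => \sum_(i | P i) F i s) = \sum_(i | P i) Eseq t (F i).
Proof.
elim: t F => [|t IH] F //=; rewrite -IH; apply: eq_Eseq => s.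
by rewrite exchange_big; apply: eq_bigr => o _; rewrite mulr_sumr.
Qed.

Lemma EseqZ (t : nat) (a : R) (F : seq T -> R) :
  Eseq t (fun s => a * F s) = a * Eseq t F.
Proof.
elim: t F => [|t IH] F //=; rewrite -IH; apply: eq_Eseq => s.
by rewrite mulr_sumr; apply: eq_bigr => o _; rewrite mulrCA.
Qed.

Hypothesis w0 : forall o, 0 <= w o.

Lemma Eseq_le (t : nat) (F F' : seq T -> R) :
  (forall s, F s <= F' s) -> Eseq t F <= Eseq t F'.
Proof.
elim: t F F' => [|t IH] F F' FF' /=; first exact: FF'.
by apply: IH => s; apply: ler_sum => o _; rewrite ler_wpM2l.
Qed.

Lemma EseqB (t : nat) (F F' : seq T -> R) :
  Eseq t (fun s => F s - F' s) = Eseq t F - Eseq t F'.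
Proof.
rewrite -[X in _ = _ - X]mul1r -mulNr -EseqZ.
have := @Eseq_sum bool xpredT t (fun b s => if b then F s else -1 * F' s).
by rewrite big_bool /= => <-; apply: eq_Eseq => s; rewrite big_bool /= mulN1r.
Qed.

Lemma Eseq_norm (t : nat) (F : seq T -> R) :
  `|Eseq t F| <= Eseq t (fun s => `|F s|).
Proof.
rewrite ler_norml; apply/andP; split; last first.
  by apply: Eseq_le => s; exact: ler_norm.
rewrite -mulN1r -EseqZ; apply: Eseq_le => s.
by rewrite mulN1r lerNl -normrN ler_norm.
Qed.

End RandomSequence.

Lemma sum_mul_eq (R : realType) (I : finType) (P : pred I) (F : I -> R) (j : I) :
  \sum_(i | P i) F i * (i == j)%:R = (P j)%:R * F j.
Proof.
have [Pj|/negbTE Pj] := boolP (P j).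
  rewrite (bigD1 j) //= eqxx mulr1 mul1r big1 ?addr0 // => i /andP[_ /negbTE ->].
  by rewrite mulr0.
rewrite big1 ?mul0r // => i Pi; case: eqP => [ij|_]; last by rewrite mulr0.
by rewrite ij Pj in Pi.
Qed.

(** These are the sets containing [v] that induce a connected subgraph. *)
Definition rooted (V : finType) (G : sgraph V) (v : V) (A : {set V}) : bool :=
  (v \in A) && reach G [set v]%SET (A :\ v).

(** [set0] is the absorbing dead state. Moves that would leave the rooted sets are rejected, except
    the death of the singleton of [v]. *)
Definition cluster_step (V : finType) (G : sgraph V) (v : V)
    (o : V * bool) (A : {set V}) : {set V} :=
  if A == set0 then set0
  else if o.2 then if rooted G v (o.1 |: A) then o.1 |: A else A
  else if rooted G v (A :\ o.1) || (A :\ o.1 == set0) then A :\ o.1 else A.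

Definition cluster (V : finType) (G : sgraph V) (v : V) (s : seq (V * bool)) :
  {set V} := foldr (cluster_step G v) [set v]%SET s.

Definition site_weight (R : realType) (V : finType) (lam : R) (o : V * bool) : R :=
  #|V|%:R^-1 * ((if o.2 then lam else 1) / (1 + lam)).

Section Cluster.
Variables (R : realType) (V : finType) (G : sgraph V) (v : V) (lam : R).
Hypothesis lam0 : 0 < lam.

Let w := @site_weight R V lam.

Lemma site_weight_ge0 (o : V * bool) : 0 <= w o.
Proof.
rewrite /w /site_weight mulr_ge0 ?invr_ge0 // divr_ge0 ?addr_ge0 ?ltW //.
by case: ifP.
Qed.

Lemma sum_site_weight : \sum_o w o = 1.
Proof.
have V0 : (0 < #|V|)%N by apply/card_gt0P; exists v.
rewrite (eq_bigr (fun o : V * bool => w (o.1, o.2))); last by case.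
rewrite -(pair_bigA _ (fun u b => w (u, b))) /=.
rewrite (eq_bigr (fun=> #|V|%:R^-1)) => [|u _].
  by rewrite sumr_const -[LHS]mulr_natr mulVf // pnatr_eq0 -lt0n.
rewrite big_bool /w /site_weight /= -mulrDr -mulrDl addrC divff ?mulr1 //.
by rewrite gt_eqF // addr_gt0.
Qed.

Lemma rooted_neq0 (A : {set V}) : rooted G v A -> A == set0 = false.
Proof. by case/andP=> vA _; apply/negbTE/set0Pn; exists v. Qed.

Lemma rooted1 : rooted G v [set v]%SET.
Proof. by rewrite /rooted set11 setDv reach0. Qed.

Lemma cluster_inv (s : seq (V * bool)) :
  (cluster G v s == set0) || rooted G v (cluster G v s).
Proof.
elim: s => [|[u b] s]; first by rewrite /= rooted1 orbT.
rewrite /cluster /=; move: (foldr _ _ s) => A.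
rewrite /cluster_step; case: ifP => [_ _|A0 /= gA]; first by rewrite eqxx.
case: b; case: ifP => [gA'|_]; rewrite ?gA ?orbT //.
  by rewrite gA' orbT.
by rewrite orbC gA'.
Qed.

(** This and [cluster_step_off] list the rooted predecessors of [B] under a single draw, as the
    balance equation requires. *)
Lemma cluster_step_on (u : V) (A B : {set V}) : rooted G v A -> rooted G v B ->
  (cluster_step G v (u, true) A == B) =
  if u \in B then (A == B) || (A == B :\ u)
  else (A == B) && ~~ rooted G v (u |: B).
Proof.
move=> gA gB; rewrite /cluster_step rooted_neq0 //=.
have [uB|uB] := boolP (u \in B).
  case: ifP => [gu|gu].
    apply/eqP/orP => [<-|[]/eqP ->]; last by rewrite setD1K.
      have [uA|uA] := boolP (u \in A); [left|right]; apply/eqP.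
        by apply/esym/setUidPr; rewrite sub1set.
      by rewrite setU1K.
    by apply/setUidPr; rewrite sub1set.
  have [//|_ /=] := eqVneq A B; apply/esym/negbTE/eqP => AB.
  by rewrite AB setD1K ?gB in gu.
case: ifP => gu.
  apply/eqP/andP => [AB|[/eqP AB]]; last by rewrite -AB gu.
  by move: uB; rewrite -AB setU11.
by apply/eqP/andP => [<-|[/eqP]//]; rewrite gu.
Qed.

Lemma cluster_step_off (u : V) (A B : {set V}) : rooted G v A -> rooted G v B ->
  (cluster_step G v (u, false) A == B) =
  if u \in B then (A == B) && ~~ (rooted G v (B :\ u) || (B :\ u == set0))
  else (A == B) || (A == u |: B).
Proof.
move=> gA gB; rewrite /cluster_step rooted_neq0 //=.
have [uB|uB] := boolP (u \in B).
  case: ifP => gu.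
    apply/eqP/andP => [AB|[/eqP AB]]; last by rewrite -AB gu.
    by move: uB; rewrite -AB setD11.
  by apply/eqP/andP => [<-|[/eqP]//]; rewrite gu.
have uBB : B :\ u = B.
  by apply/setP => x; rewrite !inE; case: eqP => // ->; rewrite (negbTE uB).
case: ifP => [gu|gu].
  apply/eqP/orP => [<-|[]/eqP ->]; last by rewrite setU1K.
    have [uA|uA] := boolP (u \in A); [right|left]; apply/eqP.
      by rewrite setD1K.
    apply/setP => x; rewrite !inE; case: eqP => // ->.
    by rewrite (negbTE uA).
  by [].
have [//|_ /=] := eqVneq A B; apply/esym/negbTE/eqP => AB.
by rewrite AB setU1K ?gB in gu.
Qed.

(** For fixed [u] the moves only link [B :\ u] and [u |: B], upwards at rate [lam] and downwards at
    rate 1, so the weights [lam ^+ #|A|] are in detailed balance, and rejected moves stay put. The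
    one defect is the pair formed by the singleton of [v] and [set0]: the weight [lam] that dies
    there never returns. *)
Lemma cluster_balance_at (u : V) (B : {set V}) : rooted G v B ->
  \sum_(A | rooted G v A) lam ^+ #|A| *
     (lam * (cluster_step G v (u, true) A == B)%:R
      + (cluster_step G v (u, false) A == B)%:R)
  = (1 + lam) * lam ^+ #|B| - lam * ((u == v) && (B == [set v]%SET))%:R.
Proof.
move=> gB.
pose pick (C : {set V}) := @sum_mul_eq R _ (rooted G v) (fun A => lam ^+ #|A|) C.
have [uB|uB] := boolP (u \in B).
  have BuB : (B :\ u == B) = false.
    by apply/negP => /eqP/setP/(_ u); rewrite setD11 uB.
  have cB : lam ^+ #|B| = lam * lam ^+ #|B :\ u|.
    by rewrite (cardsD1 u B) uB exprS.
  have e0 : (B :\ u == set0) = (u == v) && (B == [set v]%SET).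
    apply/eqP/andP => [B0|[/eqP -> /eqP ->]]; last by rewrite setDv.
    have Bu : B = [set u]%SET by rewrite -(setD1K uB) B0 setU0.
    have : v \in B by case/andP: gB.
    by rewrite Bu inE => /eqP ->; rewrite !eqxx.
  transitivity (lam * (\sum_(A | rooted G v A) lam ^+ #|A| * (A == B)%:R
       + \sum_(A | rooted G v A) lam ^+ #|A| * (A == B :\ u)%:R)
     + (~~ (rooted G v (B :\ u) || (B :\ u == set0)))%:R *
       \sum_(A | rooted G v A) lam ^+ #|A| * (A == B)%:R).
    rewrite -big_split !mulr_sumr -big_split; apply: eq_bigr => A gA /=.
    rewrite cluster_step_on // cluster_step_off // uB.
    have [->|AB] := eqVneq A B.
      rewrite [B == _]eq_sym BuB /=; ring.
    rewrite /=; ring.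
  rewrite !pick gB mul1r -e0 cB; have [->|_] := eqVneq (B :\ u) set0.
    rewrite (_ : rooted G v set0 = false) /=; last by rewrite /rooted inE.
    rewrite cards0 expr0; ring.
  case: (rooted G v (B :\ u)) => /=; ring.
transitivity (lam * (~~ rooted G v (u |: B))%:R *
    (\sum_(A | rooted G v A) lam ^+ #|A| * (A == B)%:R)
  + (\sum_(A | rooted G v A) lam ^+ #|A| * (A == B)%:R
    + \sum_(A | rooted G v A) lam ^+ #|A| * (A == u |: B)%:R)).
  rewrite !mulr_sumr -!big_split; apply: eq_bigr => A gA /=.
  rewrite cluster_step_on // cluster_step_off // (negbTE uB).
  have [->|AB] := eqVneq A B; last by rewrite /=; ring.
  have -> : (B == u |: B) = false.
    by apply/negP => /eqP/setP/(_ u); rewrite setU11 (negbTE uB).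
  rewrite /=; ring.
rewrite !pick gB cardsU1 uB exprS.
have -> : (u == v) && (B == [set v]%SET) = false.
  by apply/negP => /andP[/eqP uv /eqP Bv]; move: uB; rewrite Bv uv set11.
case: (rooted G v (u |: B)) => /=; ring.
Qed.

(** The weight lost per step: the weight [lam] of the singleton of [v] times the probability of the
    draw [(v, false)]. *)
Let kill : R := #|V|%:R^-1 * (lam / (1 + lam)).

Lemma cluster_balance (B : {set V}) : rooted G v B ->
  \sum_(A | rooted G v A) lam ^+ #|A| *
     (\sum_o w o * (cluster_step G v o A == B)%:R)
  = lam ^+ #|B| - kill * (B == [set v]%SET)%:R.
Proof.
move=> gB; have V0 : (0 < #|V|)%N by apply/card_gt0P; exists v.
have nV : #|V|%:R != 0 :> R by rewrite pnatr_eq0 -lt0n.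
have nl : 1 + lam != 0 by rewrite gt_eqF // addr_gt0.
transitivity (\sum_(u : V) #|V|%:R^-1 * (1 + lam)^-1 *
   (\sum_(A | rooted G v A) lam ^+ #|A| *
     (lam * (cluster_step G v (u, true) A == B)%:R
      + (cluster_step G v (u, false) A == B)%:R))).
  under [RHS]eq_bigr do rewrite mulr_sumr; rewrite exchange_big.
  apply: eq_bigr => A gA; rewrite mulr_sumr.
  rewrite (eq_bigr (fun o : V * bool =>
    lam ^+ #|A| * (w (o.1, o.2) * (cluster_step G v (o.1, o.2) A == B)%:R))); last first.
    by case.
  rewrite -(pair_bigA _ (fun u b =>
    lam ^+ #|A| * (w (u, b) * (cluster_step G v (u, b) A == B)%:R))) /=.
  apply: eq_bigr => u _; rewrite big_bool /= /w /site_weight /=.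
  ring.
under eq_bigr do rewrite cluster_balance_at //.
rewrite -mulr_sumr sumrB big_const iter_addr_0 -mulr_sumr.
have -> : \sum_(u : V) ((u == v) && (B == [set v]%SET))%:R = (B == [set v]%SET)%:R :> R.
  rewrite (bigD1 v) //= eqxx big1 ?addr0 // => u /negbTE -> //.
rewrite -mulr_natr /kill; field.
by rewrite nV nl.
Qed.

(** The expected time spent in [B] is at most [lam ^+ #|B| / kill]. Survival only becomes less
    likely with time, so [t] times the survival probability at [t] is at most the total time spent
    alive. *)
Lemma cluster_alive_le (t : nat) :
  kill * (t%:R * Eseq w t (fun s => (cluster G v s != set0)%:R))
  <= \sum_(A | rooted G v A) lam ^+ #|A|.
Proof.
have w_ge0 := site_weight_ge0.
pose mu t A := Eseq w t (fun s => (cluster G v s == A)%:R).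
have alive0 k : Eseq w k (fun s => (cluster G v s != set0)%:R)
    = \sum_(A | rooted G v A) mu k A.
  rewrite -Eseq_sum; apply: eq_Eseq => s.
  transitivity (\sum_(A | rooted G v A) 1 * (A == cluster G v s)%:R : R); last first.
    by apply: eq_bigr => A _; rewrite mul1r eq_sym.
  rewrite sum_mul_eq mulr1.
  have := cluster_inv s; case: eqP => [->|_ /= ->//].
  by rewrite /rooted inE.
(* The Markov property; [set0] is absorbing, hence only rooted sets feed a rooted [B]. *)
have muS k B : rooted G v B -> mu k.+1 B =
    \sum_(A | rooted G v A) mu k A * (\sum_o w o * (cluster_step G v o A == B)%:R).
  move=> gB; transitivity (\sum_(A | rooted G v A) Eseq w k (fun s =>
      (\sum_o w o * (cluster_step G v o A == B)%:R) * (cluster G v s == A)%:R)).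
    rewrite -Eseq_sum /mu /=; apply: eq_Eseq => s.
    under [RHS]eq_bigr do rewrite [_ == _ :> {set V}]eq_sym.
    rewrite sum_mul_eq; have [C0|C0] := eqVneq (cluster G v s) set0.
      rewrite C0 {1}/rooted inE mul0r big1 // => o _.
      rewrite /cluster_step eqxx.
      by rewrite [set0 == _]eq_sym rooted_neq0 ?mulr0.
    by have := cluster_inv s; rewrite (negbTE C0) /= => ->; rewrite mul1r.
  by apply: eq_bigr => A _; rewrite EseqZ mulrC.
have kill0 : 0 <= kill.
  by rewrite mulr_ge0 ?invr_ge0 // divr_ge0 ?addr_ge0 ?ltW.
(* Time 0 contributes exactly the defect in [cluster_balance]; the later times are one-step images
   of the first [k], so the induction hypothesis is pushed through the balance equation. *)
have occupation k B : rooted G v B ->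
    kill * (\sum_(i < k) mu i B) <= lam ^+ #|B|.
  elim: k B => [|k IH] B gB; first by rewrite big_ord0 mulr0 exprn_ge0 ?ltW.
  rewrite big_ord_recl mulrDr (eq_bigr (fun i : 'I_k => mu i.+1 B)) //.
  have -> : mu 0%N B = (B == [set v]%SET)%:R by rewrite /mu /= eq_sym.
  rewrite -lerBrDl -cluster_balance //.
  under [X in kill * X]eq_bigr do rewrite muS //.
  rewrite exchange_big mulr_sumr; apply: ler_sum => A gA.
  rewrite -mulr_suml mulrA ler_wpM2r ?IH //.
  by apply: sumr_ge0 => o _; rewrite mulr_ge0.
have alive_le k l : (k <= l)%N ->
    Eseq w l (fun s => (cluster G v s != set0)%:R)
    <= Eseq w k (fun s => (cluster G v s != set0)%:R).
  elim: l => [|l IH]; first by rewrite leqn0 => /eqP ->.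
  rewrite leq_eqVlt => /predU1P[->//|]; rewrite ltnS => /IH; apply: le_trans.
  rewrite /=; apply: Eseq_le => // s.
  have [C0|_] := eqVneq (cluster G v s) set0.
    rewrite big1 // => o _; rewrite C0 /cluster_step eqxx.
    by rewrite eqxx mulr0.
  apply: (@le_trans _ _ (\sum_o w o)).
    by apply: ler_sum => o _; rewrite ler_piMr // lern1 leq_b1.
  by rewrite sum_site_weight.
apply: (@le_trans _ _ (kill * \sum_(i < t) \sum_(A | rooted G v A) mu i A)).
  apply: ler_wpM2l => //; rewrite -[t in t%:R]card_ord -sumr_const mulr_suml.
  apply: ler_sum => i _; rewrite mul1r -alive0.
  by apply: alive_le; exact: ltnW.
rewrite exchange_big mulr_sumr; apply: ler_sum => A gA.
exact: occupation.
Qed.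

End Cluster.

(** * The Gibbs sampler *)

Definition upd (V : finType) (v : V) (b : bool) (s : config V) : config V :=
  [ffun w => if w == v then b else s w].

Definition unblocked (V : finType) (G : sgraph V) (v : V) (s : config V) : bool :=
  [forall y, adj G v y ==> ~~ s y].

Definition gibbs_map (V : finType) (G : sgraph V) (o : V * bool) (s : config V) :
  config V := upd o.1 (o.2 && unblocked G o.1 s) s.

Definition indep (V : finType) (G : sgraph V) (s : config V) : bool :=
  [forall u, forall y, adj G u y ==> ~~ (s u && s y)].

Lemma indepP (V : finType) (G : sgraph V) (s : config V) :
  reflect (forall u y, adj G u y -> ~~ (s u && s y)) (indep G s).
Proof.
apply: (iffP forallP) => h u; first by move=> y uy; have /forallP/(_ y) := h u; rewrite uy.
by apply/forallP => y; apply/implyP; exact: h.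
Qed.

Lemma indep_upd (V : finType) (G : sgraph V) (v : V) (b : bool) (s : config V) :
  indep G s -> indep G (upd v b s) = b ==> unblocked G v s.
Proof.
move/indepP => is_; apply/indepP/implyP => [h bt|h u y uy].
  apply/forallP => y; apply/implyP => vy; have := h _ _ vy.
  by rewrite !ffunE eqxx bt /= eq_sym (negbTE (adj_neq vy)).
rewrite !ffunE; case: eqVneq => [uv|_]; case: eqVneq => [yv|_].
- by move: (adj_neq uy); rewrite uv yv eqxx.
- case: b h => // /(_ isT)/forallP/(_ y); by rewrite -uv uy.
- case: b h; rewrite ?andbF // => /(_ isT)/forallP/(_ u).
  by rewrite -yv adj_sym uy andbT.
- exact: is_.
Qed.

Lemma upd_upd (V : finType) (v : V) (a b : bool) (s : config V) :
  upd v a (upd v b s) = upd v a s.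
Proof. by apply/ffunP => w; rewrite !ffunE; case: (w == v). Qed.

Lemma upd_id (V : finType) (v : V) (s : config V) : upd v (s v) s = s.
Proof. by apply/ffunP => w; rewrite !ffunE; case: eqP => [->|]. Qed.

Lemma upd_inj (V : finType) (v : V) (a b : bool) (s : config V) :
  (upd v a s == upd v b s) = (a == b).
Proof.
by apply/eqP/eqP => [/ffunP/(_ v)|-> //]; rewrite !ffunE eqxx.
Qed.

Lemma agree_offE (V : finType) (v : V) (s r : config V) :
  agree_off v s r = (r == upd v (r v) s).
Proof.
apply/forallP/eqP => [h|-> w].
  apply/ffunP => w; rewrite ffunE; case: eqVneq => [->//|wv].
  by have := h w; rewrite wv => /eqP.
by apply/implyP => /negbTE wv; rewrite ffunE wv.
Qed.

Lemma agree_off_upd (V : finType) (v : V) (b : bool) (s : config V) :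
  agree_off v s (upd v b s).
Proof. by rewrite agree_offE ffunE eqxx. Qed.

Lemma sum_agree_off (R : realType) (V : finType) (v : V) (s : config V)
    (F : config V -> R) :
  \sum_(r | agree_off v s r) F r = F (upd v true s) + F (upd v false s).
Proof.
rewrite (bigD1 (upd v true s)) ?agree_off_upd //=; congr (_ + _).
rewrite (big_pred1 (upd v false s)) // => r.
apply/andP/eqP => [[]|->]; last by rewrite agree_off_upd upd_inj.
by rewrite agree_offE => /eqP ->; rewrite upd_inj; case: (r v).
Qed.

Section Hardcore.
Variables (R : realType) (V : finType) (G : sgraph V) (beta : R).

Let lam : R := expR beta.
Let w := @site_weight R V lam.
Let W := hardcore_weight beta G.
Let P := hardcore beta G.

Let lam0 : 0 < lam. Proof. exact: expR_gt0. Qed.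

Lemma hardcore_weightE (s : config V) :
  W s = expR (beta * \sum_(u : V) (s u)%:R) * (indep G s)%:R.
Proof.
rewrite /W /hardcore_weight; congr (_ * _).
have edgeE (x y : V) : x != y -> (\prod_(u in [set x; y]%SET) s u)%N == 0%N = ~~ (s x && s y).
  move=> xy; rewrite big_setU1 ?inE //= big_set1.
  by case: (s x); case: (s y).
have [/indepP h|] := boolP (indep G s).
  rewrite big1 // => e eG; have /eqP/cards2P[x [y [xy exy]]] := edges_card2 eG.
  by rewrite exy edgeE // h // /adj -exy.
case/forallPn => x /forallPn[y]; rewrite negb_imply negbK => /andP[xy sxy].
rewrite (bigD1 [set x; y]%SET) //= edgeE ?(adj_neq xy) //.
by rewrite sxy /= mul0r.
Qed.

Lemma hardcore_weight_ge0 (s : config V) : 0 <= W s.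
Proof. by rewrite hardcore_weightE mulr_ge0 ?expR_ge0. Qed.

Lemma hardcore_weight_gt0 (s : config V) : (0 < W s) = indep G s.
Proof.
rewrite hardcore_weightE; case: indep; rewrite ?mulr0 ?ltxx // mulr1.
exact: expR_gt0.
Qed.

Lemma hardcore_norm_gt0 : 0 < \sum_s W s.
Proof.
rewrite (bigD1 [ffun=> false]) //= ltr_pwDl ?hardcore_weight_gt0 //.
  by apply/indepP => u y _; rewrite !ffunE.
by apply: sumr_ge0 => s _; exact: hardcore_weight_ge0.
Qed.

Lemma hardcore_gt0 (s : config V) : (0 < P s) = indep G s.
Proof.
by rewrite -hardcore_weight_gt0 /P /hardcore pmulr_lgt0 ?invr_gt0 ?hardcore_norm_gt0.
Qed.

Lemma hardcore_ge0 (s : config V) : 0 <= P s.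
Proof.
by rewrite divr_ge0 ?hardcore_weight_ge0 ?ltW ?hardcore_norm_gt0.
Qed.

Lemma sum_hardcore : \sum_s P s = 1.
Proof. by rewrite -mulr_suml divff // gt_eqF // hardcore_norm_gt0. Qed.

(** Occupying [v] multiplies the weight by [lam] if no neighbour is occupied and makes it zero
    otherwise; this fixes the conditional law at [v]. *)
Lemma hardcore_upd (v : V) (s : config V) : indep G s ->
  P (upd v true s) = lam * (unblocked G v s)%:R * P (upd v false s).
Proof.
move=> is_; have sumE b : \sum_(u : V) (upd v b s u)%:R
    = b%:R + \sum_(u | u != v) (s u)%:R :> R.
  rewrite (bigD1 v) //= ffunE eqxx; congr (_ + _); apply: eq_bigr => u /negbTE uv.
  by rewrite ffunE uv.
rewrite /P /hardcore -/W !hardcore_weightE !indep_upd //= !sumE mulrDr mulr1 expRD.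
rewrite add0r; case: (unblocked G v s); rewrite ?mulr0 ?mul0r // !mulr1.
by rewrite !mulrA.
Qed.

(** Random map representation of the sampler. At a blocked site both bits give the unoccupied value,
    matching a conditional law concentrated there. *)
Lemma gibbs_kernelE (s s' : config V) : 0 < P s ->
  gibbs_kernel P s s' = \sum_o w o * (gibbs_map G o s == s')%:R.
Proof.
rewrite hardcore_gt0 => is_.
have nl : 1 + lam != 0 by rewrite gt_eqF // addr_gt0.
rewrite [RHS](eq_bigr (fun o : V * bool =>
    w (o.1, o.2) * (gibbs_map G (o.1, o.2) s == s')%:R)); last by case.
rewrite -(pair_bigA _ (fun u b => w (u, b) * (gibbs_map G (u, b) s == s')%:R)) /=.
apply: eq_bigr => v _; rewrite big_bool /= /w /site_weight /gibbs_map /=.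
rewrite -!(mulrA #|V|%:R^-1) -mulrDr; congr (_ * _); rewrite sum_agree_off hardcore_upd //.
have nP : P (upd v false s) != 0.
  by rewrite gt_eqF // hardcore_gt0 indep_upd.
have nQ : lam * P (upd v false s) + P (upd v false s) != 0.
  by rewrite -[X in _ + X]mul1r -mulrDl mulf_neq0 // addrC.
have [|nagr] := boolP (agree_off v s s'); last first.
  have ne b : (upd v b s == s') = false.
    by apply/negP => /eqP e; move: nagr; rewrite -e agree_off_upd.
  by rewrite !ne !mulr0 addr0.
rewrite agree_offE => /eqP ->; rewrite !upd_inj; case: (s' v).
  rewrite hardcore_upd //; case: (unblocked G v s) => /=; last by field; rewrite ?nP ?nl ?nQ.
  by field; rewrite ?nP ?nl ?nQ.
case: (unblocked G v s) => /=; last by field; rewrite ?nP ?nl ?nQ.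
by field; rewrite ?nP ?nl ?nQ.
Qed.

Lemma gibbs_stationary (V0 : (0 < #|V|)%N) (s' : config V) : 0 < P s' ->
  \sum_s P s * gibbs_kernel P s s' = P s'.
Proof.
move=> Ps'; rewrite /gibbs_kernel; under eq_bigr do rewrite mulr_sumr.
rewrite exchange_big (eq_bigr (fun=> #|V|%:R^-1 * P s')) => [|v _]; last first.
  (* Reversibility at each [v]: [s] and [s'] lie in the same class off [v], so they share the
     normalization and may exchange roles. *)
  rewrite /= (eq_bigr (fun s => #|V|%:R^-1 * (P s' / \sum_(r | agree_off v s' r) P r)
      * (if agree_off v s' s then P s else 0))) => [|s _].
    rewrite -mulr_sumr -big_mkcond -(mulrA #|V|%:R^-1) divfK //.
    rewrite gt_eqF // (bigD1 s') /=; last by rewrite agree_offE upd_id.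
    by rewrite ltr_pwDl // sumr_ge0 // => r _; exact: hardcore_ge0.
  have -> : agree_off v s s' = agree_off v s' s.
    rewrite !agree_offE; apply/eqP/eqP => [->|->]; by rewrite upd_upd upd_id.
  have [|_] := boolP (agree_off v s' s); last by rewrite !mulr0.
  rewrite agree_offE => /eqP e; rewrite !sum_agree_off e !upd_upd.
  by rewrite mulrC.
by rewrite sumr_const -[LHS]mulr_natr mulrAC mulVf ?mul1r // pnatr_eq0 -lt0n.
Qed.

Lemma gibbs_map_indep (o : V * bool) (s : config V) :
  indep G s -> indep G (gibbs_map G o s).
Proof.
by move=> is_; rewrite indep_upd //; apply/implyP => /andP[].
Qed.

Lemma foldr_gibbs_indep (t : seq (V * bool)) (s : config V) :
  indep G s -> indep G (foldr (gibbs_map G) s t).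
Proof. by move=> is_; elim: t => //= o t; exact: gibbs_map_indep. Qed.

End Hardcore.

(* A disagreement can only reach u when u draws b = true and is adjacent to a
   disagreeing site, in which case a cluster containing that site absorbs u. *)
Lemma disagreement_in_cluster (V : finType) (G : sgraph V) (t : seq (V * bool))
    (x z : config V) (u : V) :
  foldr (gibbs_map G) x t u != foldr (gibbs_map G) z t u ->
  exists v, u \in cluster G v t.
Proof.
elim: t u => [|[y b] t IH] u /=; first by exists u; rewrite /cluster /= inE.
move: IH; set X := foldr _ x t; set Z := foldr _ z t => IH.
rewrite !ffunE /=; case: (eqVneq u y) => [->|uy].
  (* A draw with [b = false] empties [y] in both copies. With [b = true], a disagreement at [y]
     means that the copies already differed at a neighbour of [y]. *)
  case: b => //=; rewrite /unblocked => neq.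
  have [y' yy' XZ] : exists2 y', adj G y y' & X y' != Z y'.
    apply/exists_inP; apply: contraR neq => /exists_inPn h.
    apply/eqP/eq_forallb => y'; have [yy'|//] := boolP (adj G y y').
    by have := h _ yy'; rewrite negbK => /eqP ->.
  have [v y'C] := IH _ XZ; exists v; rewrite /= /cluster_step /= -/(cluster G v t).
  have := cluster_inv G v t; case: eqP => [C0|_ /= /andP[vC rC]].
    by rewrite C0 inE in y'C.
  have -> : rooted G v (y |: cluster G v t); last by rewrite setU11.
  rewrite /rooted inE vC orbT /=; apply/reachP => B Bs B0.
  (* A cut that misses the old cluster can only be [y] alone, left through the edge to [y']; any
     other cut is left through an edge inside the cluster. *)
  have [B'0|B'0] := eqVneq (B :&: cluster G v t) set0.
    have /set0Pn[a aB] := B0.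
    have nC c : c \in B -> c \notin cluster G v t.
      move=> cB; apply/negP => cC; move/setP/(_ c): B'0; rewrite !inE cB cC //.
    have Ba c : c \in B -> c = y.
      move=> cB; move/subsetP/(_ c cB): Bs; rewrite !inE (negbTE (nC c cB)) orbF.
      by case/andP=> _ /eqP.
    exists y, y'; split=> //.
    - by rewrite -(Ba a aB).
    - by rewrite !inE y'C orbT andbT orbN.
    - by apply/negP => /nC; rewrite y'C.
  have /reachP/(_ (B :&: cluster G v t)) := rC; case=> //.
    apply/subsetP => c; rewrite !inE => /andP[cB ->]; rewrite andbT.
    by move/subsetP/(_ c cB): Bs; rewrite !inE => /andP[].
  move=> a [c [aB cA cB ac]]; exists a, c; split=> //.
  - by move: aB; rewrite inE => /andP[].
  - by move: cA; rewrite !inE; case: (c == v) => //= ->; rewrite orbT.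
  - apply: contra cB => cB; rewrite inE cB.
    by move: cA; rewrite !inE => /orP[/eqP -> //|/andP[]].
(* Here [u] is not the drawn site, and a cluster step never drops any site but the drawn one. *)
move=> XZ; have [v uC] := IH _ XZ; exists v.
rewrite /= /cluster_step /= -/(cluster G v t); case: ifP => [/eqP C0|_].
  by rewrite C0 inE in uC.
by case: b; case: ifP => _ //; rewrite !inE ?uy ?uC ?orbT.
Qed.

(** * Mixing time *)

Lemma le_sum_term (R : realType) (I : finType) (F : I -> R) (i : I) (a : R) :
  (forall j, 0 <= F j) -> a <= F i -> a <= \sum_j F j.
Proof.
by move=> F0 /le_trans; apply; rewrite (bigD1 i) //= lerDl sumr_ge0.
Qed.

Section Mixing.
Variables (R : realType) (V : finType) (G : sgraph V) (beta : R).
Hypothesis V0 : (0 < #|V|)%N.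

Let lam : R := expR beta.
Let w := @site_weight R V lam.
Let P := hardcore beta G.
Let K := fun s s' : state_space P => gibbs_kernel P (val s) (val s').
Let path (x : state_space P) (s : seq (V * bool)) := foldr (gibbs_map G) (val x) s.

Let w_ge0 (o : V * bool) : 0 <= w o.
Proof. by apply: site_weight_ge0; exact: expR_gt0. Qed.

Let sum_state_space (F : config V -> R) :
  \sum_(z : state_space P) F (val z) = \sum_(s | 0 < P s) F s.
Proof.
rewrite [RHS](reindex_omap (val : state_space P -> _) insub) /=.
  by apply: eq_bigl => z; rewrite valK eqxx andbT (valP z).
by move=> s Ps; rewrite insubT.
Qed.

Let path_gt0 (x : state_space P) (s : seq (V * bool)) : 0 < P (path x s).
Proof.
rewrite hardcore_gt0 foldr_gibbs_indep // -(hardcore_gt0 G beta).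
exact: (valP x).
Qed.

(** The path stays in the support of [P], so [gibbs_kernelE] applies to every new draw at the head
    of the sequence. *)
Lemma chain_lawE (x y : state_space P) (t : nat) :
  chain_law K x t y = Eseq w t (fun s => (path x s == val y)%:R).
Proof.
elim: t y => [|t IH] y; first by rewrite /chain_law /= eq_sym.
rewrite /chain_law iterS -/(chain_law K x t).
transitivity (\sum_(z : state_space P)
    Eseq w t (fun s => K z y * (path x s == val z)%:R)).
  by apply: eq_bigr => z _; rewrite EseqZ -IH mulrC.
rewrite -Eseq_sum /=; apply: eq_Eseq => s; rewrite /K.
under eq_bigr do rewrite eq_sym.
rewrite (sum_state_space (fun z => gibbs_kernel P z (val y) * (z == path x s)%:R)).
by rewrite sum_mul_eq path_gt0 mul1r gibbs_kernelE ?path_gt0.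
Qed.

Lemma chain_law_stationary (y : state_space P) (t : nat) :
  \sum_(z : state_space P) P (val z) * chain_law K z t y = P (val y).
Proof.
elim: t y => [|t IH] y.
  rewrite (bigD1 y) //= /chain_law /= eqxx mulr1 big1 ?addr0 // => z zy.
  by rewrite eq_sym (negbTE zy) mulr0.
transitivity (\sum_(u : state_space P)
    (\sum_(z : state_space P) P (val z) * chain_law K z t u) * K u y).
  rewrite /chain_law /=; under eq_bigr do rewrite mulr_sumr.
  rewrite exchange_big; apply: eq_bigr => u _; rewrite mulr_suml.
  by apply: eq_bigr => z _; rewrite mulrA.
under eq_bigr do rewrite IH.
rewrite /K (sum_state_space (fun u => P u * gibbs_kernel P u (val y))).
rewrite -[RHS](gibbs_stationary V0 (valP y)) big_mkcond; apply: eq_bigr => u _.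
case: ltP => // Pu; have /eqP -> : hardcore beta G u == 0 by rewrite eq_le Pu hardcore_ge0.
by rewrite mul0r.
Qed.

Let alive (t : nat) : R :=
  \sum_(v : V) Eseq w t (fun s => (cluster G v s != set0)%:R).

(** Coupling by common draws: if the copies differ, some cluster is alive and the two point masses
    are at distance at most 2. The sum over [v] in [alive] is a union bound. *)
Lemma chain_law_dist (x z : state_space P) (t : nat) :
  \sum_(y : state_space P) `|chain_law K x t y - chain_law K z t y|
  <= 2 * alive t.
Proof.
apply: (@le_trans _ _ (Eseq w t (fun s => \sum_(y : state_space P)
    `|(path x s == val y)%:R - (path z s == val y)%:R|))).
  rewrite Eseq_sum; apply: ler_sum => y _; rewrite !chain_lawE -EseqB.
  exact: Eseq_norm.
rewrite /alive -Eseq_sum -EseqZ; apply: Eseq_le => // s.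
have [->|neq] := eqVneq (path x s) (path z s).
  rewrite big1 => [|y _]; last by rewrite subrr normr0.
  by rewrite mulr_ge0 // sumr_ge0.
apply: (@le_trans _ _ 2); last first.
  have [u uneq] : exists u, path x s u != path z s u.
    by apply/existsP; apply: contraR neq => /existsPn h; apply/eqP/ffunP => u;
      have := h u; rewrite negbK => /eqP.
  have [v uv] := disagreement_in_cluster uneq.
  have Cv : cluster G v s != set0 by apply/set0Pn; exists u.
  rewrite -[leLHS]mulr1; apply: ler_wpM2l; first exact: ler0n.
  by apply: (@le_sum_term _ _ _ v) => [j|]; [exact: ler0n|rewrite Cv].
apply: (@le_trans _ _ (\sum_(y : state_space P)
    ((path x s == val y)%:R + (path z s == val y)%:R))).
  by apply: ler_sum => y _; rewrite (le_trans (ler_normB _ _)) // !ger0_norm.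
have mass1 (a : state_space P) :
    \sum_(y : state_space P) (path a s == val y)%:R = 1 :> R.
  rewrite (sum_state_space (fun y => (path a s == y)%:R)).
  under eq_bigr do rewrite eq_sym -[_%:R]mul1r.
  by rewrite sum_mul_eq path_gt0 mulr1.
by rewrite big_split /= !mass1.
Qed.

(** Stationarity writes [P] as the mixture of the laws started from [z] with weights [P (val z)],
    which reduces the claim to pairs of starting states. *)
Lemma tv_dist_le_alive (x : state_space P) (t : nat) :
  tv_dist (chain_law K x t) (fun s => P (val s)) <= alive t.
Proof.
have mass1 : \sum_(z : state_space P) P (val z) = 1.
  rewrite (sum_state_space P) -(sum_hardcore G beta) big_mkcond.
  apply: eq_bigr => s _; case: ltP => // Ps.
  by apply/eqP; rewrite eq_le [X in _ && X]Ps hardcore_ge0.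
rewrite /tv_dist ler_pdivrMl //.
apply: (@le_trans _ _ (\sum_(y : state_space P) \sum_(z : state_space P)
   P (val z) * `|chain_law K x t y - chain_law K z t y|)).
  apply: ler_sum => y _.
  rewrite [X in `|X - _|](_ : _ = \sum_(z : state_space P) P (val z) * chain_law K x t y);
    last by rewrite -mulr_suml mass1 mul1r.
  rewrite -[P (val y)](chain_law_stationary y t) -sumrB.
  apply: le_trans (ler_norm_sum _ _ _) _.
  apply: ler_sum => z _.
  by rewrite -mulrBr normrM ger0_norm //; exact: hardcore_ge0.
rewrite exchange_big.
apply: (@le_trans _ _ (\sum_(z : state_space P) P (val z) * (2 * alive t)));
  last by rewrite -mulr_suml mass1 mul1r.
apply: ler_sum => z _.
rewrite -mulr_sumr; apply: ler_wpM2l; [exact: hardcore_ge0|exact: chain_law_dist].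
Qed.

Lemma gibbs_mixing_time_le (B : R) (t : nat) :
  \sum_(v : V) \sum_(A | rooted G v A) lam ^+ #|A| <= lam * B ->
  2 * expR 1 * (1 + lam) * #|V|%:R * B <= t%:R -> (0 < t)%N ->
  (gibbs_mixing_time P <= t%:R%:E)%E.
Proof.
move=> FB Bt t0; apply: ereal_inf_lbound; exists t => //= x.
have lam0 : 0 < lam := expR_gt0 beta.
have l1 : 0 < 1 + lam by rewrite addr_gt0.
apply: le_trans (tv_dist_le_alive x t) _.
pose kill : R := #|V|%:R^-1 * (lam / (1 + lam)).
have n0 : 0 < #|V|%:R :> R by rewrite ltr0n.
have kill0 : 0 < kill by rewrite mulr_gt0 ?invr_gt0 // divr_gt0.
have tR : 0 < t%:R :> R by rewrite ltr0n.
have : kill * (t%:R * alive t) <= lam * B.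
  apply: le_trans FB; rewrite /alive !mulr_sumr; apply: ler_sum => v _.
  exact: cluster_alive_le.
have e0 : 0 < expR 1 :> R := expR_gt0 1.
have kt0 : 0 < kill * t%:R by rewrite mulr_gt0.
(* Now [alive t] is at most [lam * B / (kill * t)], where [lam] cancels against [kill]; the assumed
   size of [t] is what brings this below the threshold. *)
rewrite [X in X <= _]mulrA -(ler_pdivlMl _ _ kt0) => /le_trans; apply.
rewrite -[leRHS]mul1r ler_pdivlMr; last by rewrite mulr_gt0.
rewrite -(ler_pM2l tR) mulr1.
apply: le_trans Bt; rewrite le_eqVlt; apply/orP; left; apply/eqP.
rewrite /kill; field.
by rewrite !gt_eqF.
Qed.

End Mixing.

(** * Averaging over the random graph and conclusion *)

Lemma sum_rooted (R : realType) (V : finType) (G : sgraph V) (v : V) (lam : R) :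
  \sum_(A | rooted G v A) lam ^+ #|A| =
  lam * \sum_(A : {set V} | (A \subset ~: [set v]%SET) && reach G [set v]%SET A)
          lam ^+ #|A|.
Proof.
rewrite (reindex_onto (fun A => v |: A) (fun A => A :\ v)) /=; last first.
  by move=> A /andP[vA _]; rewrite setD1K.
rewrite mulr_sumr; apply: eq_big => [A|A].
  rewrite /rooted setU11 subsetC sub1set inE /=.
  have [vA|vA] /= := boolP (v \in A); last by rewrite setU1K // eqxx andbT.
  by apply/negP => /andP[_ /eqP/setP/(_ v)]; rewrite setD11 vA.
case/andP=> _ /eqP e; have vA : v \notin A by rewrite -e setD11.
by rewrite cardsU1 vA exprS.
Qed.

Lemma expected_rooted_le (R : realType) (V : finType) (p lam : R) (v : V) :
  0 <= p <= 1 -> 0 <= lam -> lam * p * expR 1 * #|V|%:R <= 1 ->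
  \sum_(G : sgraph V) gnp p G * (\sum_(A | rooted G v A) lam ^+ #|A|)
  <= lam * expR 1.
Proof.
move=> p01 lam0 small.
have [p0 _] := andP p01.
(* The supersolution is [M = expR 1]: the power is at most the exponential of
   [lam * p * expR 1 * #|V|], whose exponent is at most 1. *)
have bound : (1 + lam * p * expR 1) ^+ #|V| <= expR 1.
  have x0 : 0 <= lam * p * expR 1 by rewrite !mulr_ge0 ?expR_ge0.
  apply: (@le_trans _ _ (expR (lam * p * expR 1) ^+ #|V|)).
    by apply: lerXn2r; rewrite ?nnegrE ?expR_ge0 ?addr_ge0 ?expR_ge1Dx.
  by rewrite -expRM_natl mulr_natl -mulr_natr ler_expR.
have := @sum_reach_le R V p lam (expR 1) p01 lam0 (expR_ge0 _) bound [set v]%SET.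
rewrite cards1 expr1 => h; apply: le_trans (ler_wpM2l lam0 h).
rewrite mulr_sumr le_eqVlt; apply/orP; left; apply/eqP.
transitivity (\sum_(G : sgraph V) \sum_(A : {set V} | (A \subset ~: [set v]%SET))
  lam * (lam ^+ #|A| * (if reach G [set v]%SET A then gnp p G else 0))).
  apply: eq_bigr => G _; rewrite sum_rooted mulrCA !mulr_sumr.
  rewrite big_mkcondr; apply: eq_bigr => A _.
  by case: ifP => _; rewrite ?mulr0 // [gnp p G * _]mulrC.
rewrite exchange_big; apply: eq_bigr => A _.
by rewrite -!mulr_sumr -big_mkcond.
Qed.

(** Markov's inequality: the mean is at most [n * lam * e] against the threshold [lam * n ^ 2], so
    failure has probability at most [e / n]. *)
Lemma gnp_prob_rooted_ge (R : realType) (n : nat) (p lam : R)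
    (Q : pred (sgraph 'I_n)) :
  (0 < n)%N -> 0 <= p <= 1 -> 0 < lam -> lam * p * expR 1 * n%:R <= 1 ->
  (forall G : sgraph 'I_n,
     \sum_(v : 'I_n) \sum_(A | rooted G v A) lam ^+ #|A| <= lam * n%:R ^+ 2 -> Q G) ->
  1 - expR 1 * n%:R^-1 <= gnp_prob p Q.
Proof.
move=> n0 p01 lam0 small hQ; have nR : 0 < n%:R :> R by rewrite ltr0n.
pose F (G : sgraph 'I_n) := \sum_(v : 'I_n) \sum_(A | rooted G v A) lam ^+ #|A|.
have F0 G : 0 <= F G.
  by apply: sumr_ge0 => v _; apply: sumr_ge0 => A _; rewrite exprn_ge0 // ltW.
have EF : \sum_G gnp p G * F G <= n%:R * (lam * expR 1).
  under eq_bigr do rewrite mulr_sumr.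
  rewrite exchange_big -[n in n%:R]card_ord -sumr_const mulr_suml.
  apply: ler_sum => v _; rewrite mul1r; apply: expected_rooted_le => //.
    exact: ltW.
  by rewrite card_ord.
have d0 : 0 < lam * n%:R ^+ 2 by rewrite mulr_gt0 // exprn_gt0.
have markov : (lam * n%:R ^+ 2) * \sum_(G | ~~ Q G) gnp p G <= n%:R * (lam * expR 1).
  apply: le_trans EF; rewrite mulr_sumr [leRHS](bigID Q) /= -[leLHS]add0r.
  apply: lerD; first by apply: sumr_ge0 => G _; rewrite mulr_ge0 ?gnp_ge0.
  apply: ler_sum => G nQ; rewrite mulrC ler_wpM2l ?gnp_ge0 //.
  by rewrite leNgt; apply: contra nQ => /ltW /hQ.
rewrite lerBlDr /gnp_prob -[leLHS](sum_gnp 'I_n p) (bigID Q) /= lerD2l.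
rewrite -(ler_pM2l d0); apply: le_trans markov _.
rewrite le_eqVlt; apply/orP; left; apply/eqP; field.
by rewrite gt_eqF.
Qed.

Theorem theorem3 (R : realType) (d : R) (hd : 1 <= d) :
  exists beta_d : R, forall beta : R, beta <= beta_d ->
  exists C K : R,
    (fun n : nat =>
       gnp_prob (d / n%:R)
         (fun G : sgraph 'I_n =>
            (gibbs_mixing_time (hardcore beta G) <= (K * n%:R `^ C)%:E)%E))
      @ \oo --> (1 : R).
Proof.
have d0 : 0 < d by rewrite (lt_le_trans _ hd).
(* The threshold at which [lam * d * e] equals 1. *)
exists (- (1 + ln d)) => beta beta_le; pose lam := expR beta.
have lam0 : 0 < lam := expR_gt0 beta.
have lamd : lam * d * expR 1 <= 1.
  rewrite -(lnK d0) -!expRD -[leRHS]expR0 ler_expR.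
  by move: (ln d) beta_le => l; lra.
pose c : R := 2 * expR 1 * (1 + lam).
have c0 : 0 <= c by rewrite !mulr_ge0 ?expR_ge0 // addr_ge0 // ltW.
(* One power of [n] comes from the choice of site, two from the Markov threshold; the extra 1
   absorbs rounding the time up to an integer. *)
exists 3%:R, (c + 1).
(* [harmonic n] is the inverse of [n + 1], so the factor 2 is needed to dominate the inverse of
   [n]. *)
apply: (@squeeze_cvgr nat \oo _ R (fun n => 1 - (2 * expR 1) * harmonic n) (fun=> 1)).
- near=> n.
  have n0 : (0 < n)%N by near: n; exact: nbhs_infty_gt.
  have dn : d <= n%:R by near: n; exact: nbhs_infty_ger.
  have nR : 0 < n%:R :> R by rewrite ltr0n.
  have p01 : 0 <= d / n%:R <= 1.
    by rewrite ler_pdivrMr // mul1r dn andbT divr_ge0 // ltW.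
  apply/andP; split; last first.
    rewrite /gnp_prob -[leRHS](sum_gnp 'I_n (d / n%:R)) [leRHS](bigID (fun G : sgraph 'I_n =>
      (gibbs_mixing_time (hardcore beta G) <= ((c + 1) * n%:R `^ 3%:R)%:E)%E)) /=.
    by rewrite lerDl sumr_ge0 // => G _; exact: gnp_ge0.
  apply: (@le_trans _ _ (1 - expR 1 * n%:R^-1)).
    rewrite lerD2l lerN2 [2 * _]mulrC -mulrA; apply: ler_wpM2l; first exact: expR_ge0.
    rewrite /harmonic ler_pdivlMr ?ltr0Sn // mulrC ler_pdivrMr // -natrM ler_nat.
    by rewrite mul2n -addnn -addn1 leq_add2l.
  apply: (@gnp_prob_rooted_ge R n _ lam) => //.
    rewrite (_ : _ * n%:R = lam * d * expR 1) //; field.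
    by rewrite gt_eqF.
  move=> G FG; pose t := (Num.truncn (c * n%:R ^+ 3)).+1.
  apply: (@le_trans _ _ t%:R%:E).
    apply: (@gibbs_mixing_time_le R 'I_n G beta _ (n%:R ^+ 2)) => //.
      by rewrite card_ord.
    rewrite card_ord -mulrA -exprS; apply/ltW; exact: truncnS_gt.
  rewrite lee_fin powR_mulrn // mulrDl mul1r /t -natr1 lerD //.
    by rewrite truncn_le // mulr_ge0 // exprn_ge0.
  by rewrite exprn_ege1 // ler1n.
- rewrite -[X in _ --> X](subr0 (1 : R)).
  apply: cvgB; first exact: cvg_cst.
  rewrite -(mulr0 (2 * expR 1)); apply: cvgMl_tmp; exact: cvg_harmonic.
- exact: cvg_cst.
Unshelve. all: by end_near.
Qed.
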